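(* Let $\mathcal{C}$ be a $\mathbf{DCPO}$-$\dagger$-category. Every functional (continuous function) $\psi:\mathcal{C}(X,Y)\times\mathcal{C}(P,Q)\to\mathcal{C}(X,Y)$, where $X,Y,P,Q$ are objects of $\mathcal{C}$, is parametrized fixed point adjoint to its conjugate $\overline{\psi}:\mathcal{C}(Y,X)\times\mathcal{C}(Q,P)\to\mathcal{C}(Y,X)$; that is, for every morphism $p:P\to Q$ of $\mathcal{C}$, $\big((\mathrm{pfix}\,\psi)(p)\big)^\dagger=(\mathrm{pfix}\,\overline{\psi})(p^\dagger)$.
   Context: $\mathbf{DCPO}$ is the category of pointed directed complete partial orders (posets with a least element $\bot$ in which every non-empty directed subset has a supremum) and continuous maps (maps preserving suprema of directed sets; they need not preserve $\bot$). A $\mathbf{DCPO}$-category is a category $\mathcal{C}$ in which each homset $\mathcal{C}(X,Y)$ is a pointed directed complete partial order (order $\sqsubseteq$, least element $\bot_{X,Y}$), and composition is continuous and strict (i.e. $\bot\circ f=\bot$ and $g\circ\bot=\bot$). A dagger category is a category $\mathcal{C}$ with a functor $(-)^\dagger:\mathcal{C}^{\mathrm{op}}\to\mathcal{C}$ that is the identity on objects, so $f:X\to Y$ gives $f^\dagger:Y\to X$, with $\mathrm{id}_X^\dagger=\mathrm{id}_X$, $(g\circ f)^\dagger=f^\dagger\circ g^\dagger$ and $f^{\dagger\dagger}=f$. A $\mathbf{DCPO}$-$\dagger$-category is a $\mathbf{DCPO}$-category that is also a dagger category and whose dagger is locally monotone: $f\sqsubseteq g$ implies $f^\dagger\sqsubseteq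 g^\dagger$ for all parallel $f,g$. Parametrized fixed points: for a continuous $\psi:A\times B\to A$ between pointed directed complete partial orders, set $\psi^0(x,p)=x$ and $\psi^{n+1}(x,p)=\psi(\psi^n(x,p),p)$; then $\mathrm{pfix}\,\psi:B\to A$ is the continuous map $(\mathrm{pfix}\,\psi)(p)=\sup_{n\in\omega}\psi^n(\bot_A,p)$. The conjugate of $\psi:\mathcal{C}(X,Y)\times\mathcal{C}(P,Q)\to\mathcal{C}(X,Y)$ is $\overline{\psi}:\mathcal{C}(Y,X)\times\mathcal{C}(Q,P)\to\mathcal{C}(Y,X)$, $\overline{\psi}(g,q)=\psi(g^\dagger,q^\dagger)^\dagger$. A functional $\psi_\ddagger:\mathcal{C}(Y,X)\times\mathcal{C}(Q,P)\to\mathcal{C}(Y,X)$ is parametrized fixed point adjoint to $\psi$ iff $\big((\mathrm{pfix}\,\psi)(p)\big)^\dagger=(\mathrm{pfix}\,\psi_\ddagger)(p^\dagger)$ for all $p:P\to Q$. *)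

(* Defs.v *)
From HB Require Import structures.
From mathcomp Require Import all_boot all_order.
From mathcomp Require Import boolp classical_sets.

Set Implicit Arguments.
Unset Strict Implicit.
Unset Printing Implicit Defensive.

Import Order.Theory.
Local Open Scope classical_set_scope.
Local Open Scope order_scope.

Section Directed.
Context {d : Order.disp_t} {T : porderType d}.

Definition directed (D : set T) : Prop :=
  D !=set0 /\ forall x y, D x -> D y -> exists z, [/\ D z, x <= z & y <= z].

Lemma isLub_uniq (D : set T) s t : isLub D s -> isLub D t -> s = t.
Proof.
move=> [Ds sD] [Dt tD]; apply/eqP.
by rewrite eq_le (sD _ Dt) (tD _ Ds).
Qed.

End Directed.

(* The [choiceType] contained in a [porderType] is no restriction: every type
   has one by [boolp.gen_choiceMixin]. *)
HB.mixin Record BPOrder_isDirectedComplete d T of Order.BPOrder d T := {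
  directed_has_lub :
    forall D : set T, directed D -> exists s : T, isLub D s
}.

#[short(type="dcpoType")]
HB.structure Definition Dcpo d :=
  {T of Order.BPOrder d T & BPOrder_isDirectedComplete d T}.

Section Sup.
Context {d : Order.disp_t} {T : dcpoType d}.

(* meaningful on directed sets only *)
Definition dsup (D : set T) : T := supremum \bot D.

Lemma dsupP (D : set T) : directed D -> isLub D (dsup D).
Proof.
move=> dD; have [s Ds] := directed_has_lub _ dD.
rewrite /dsup /supremum; case: ifPn => [/eqP D0|_].
  by case: dD => -[x]; rewrite D0.
by case: xgetP => [t _|/(_ s)]; last exact.
Qed.

End Sup.

Definition scott_continuous {d d' : Order.disp_t} {A : porderType d}
    {B : porderType d'} (f : A -> B) : Prop :=
  forall (D : set A) (s : A), directed D -> isLub D s -> isLub (f @` D) (f s).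

Record cmap {d d' : Order.disp_t} (A : porderType d) (B : porderType d') :=
  CMap { cfun :> A -> B; cmap_continuous : scott_continuous cfun }.

(* A x B is ordered componentwise: this is MathComp's [A *p B]. *)
Section Product.
Context {d1 d2 : Order.disp_t}.

Section Projections.
Context {A : porderType d1} {B : porderType d2}.
Implicit Type D : set (A *p B).

Lemma directed_fst D : directed D -> directed (fst @` D).
Proof.
move=> [[u Du] dD]; split; first by exists u.1, u.
move=> _ _ [x Dx <-] [y Dy <-]; have [z [Dz /andP[xz _] /andP[yz _]]] := dD x y Dx Dy.
by exists z.1; split=> //; exists z.
Qed.

Lemma directed_snd D : directed D -> directed (snd @` D).
Proof.
move=> [[u Du] dD]; split; first by exists u.2, u.
move=> _ _ [x Dx <-] [y Dy <-]; have [z [Dz /andP[_ xz] /andP[_ yz]]] := dD x y Dx Dy.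
by exists z.2; split=> //; exists z.
Qed.

Lemma isLub_pair D (a : A) (b : B) :
  isLub (fst @` D) a -> isLub (snd @` D) b -> isLub D ((a, b) : A *p B).
Proof.
move=> [ua la] [ub lb]; split=> [x Dx|c uc].
  by apply/andP; split; [apply: ua|apply: ub]; exists x.
apply/andP; split; [apply: la|apply: lb] => _ [x Dx <-].
  by case/andP: (uc x Dx).
by case/andP: (uc x Dx).
Qed.

End Projections.

Context {A : dcpoType d1} {B : dcpoType d2}.

Lemma prod_directed_has_lub (D : set (A *p B)) :
  directed D -> exists s : A *p B, isLub D s.
Proof.
move=> dD; have [a aD] := directed_has_lub _ (directed_fst dD).
have [b bD] := directed_has_lub _ (directed_snd dD).
by exists (a, b); apply: isLub_pair.
Qed.

End Product.

HB.instance Definition _ (d1 d2 : Order.disp_t) (A : dcpoType d1)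
    (B : dcpoType d2) :=
  BPOrder_isDirectedComplete.Build _ (A *prod[Order.prod_display d1 d2] B)
    (@prod_directed_has_lub d1 d2 A B).

Section Continuity.
Context {dA dB : Order.disp_t}.

Lemma scott_continuous_homo {A : porderType dA} {B : porderType dB}
    (f : A -> B) : scott_continuous f -> {homo f : x y / x <= y}.
Proof.
move=> fc x y xy.
have dD : directed [set x; y].
  split; first by exists x; left.
  by move=> _ _ [->|->] [->|->]; exists y; split=> //; right.
have lD : isLub [set x; y] y.
  by split=> [_ [->|->] //|b]; apply; right.
by have [+ _] := fc _ _ dD lD; apply; exists x => //; left.
Qed.

Lemma directed_image {A : porderType dA} {B : porderType dB}
    (f : A -> B) (D : set A) :
  {homo f : x y / x <= y} -> directed D -> directed (f @` D).
Proof.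
move=> fh [[u Du] dD]; split; first by exists (f u), u.
move=> _ _ [x Dx <-] [y Dy <-]; have [z [Dz xz yz]] := dD x y Dx Dy.
by exists (f z); split; [exists z|apply: fh|apply: fh].
Qed.

End Continuity.

Section Pfix.
Context {dA dB : Order.disp_t} {A : dcpoType dA} {B : dcpoType dB}.

Definition param_iter (psi : A *p B -> A) (n : nat) (x : A) (p : B) : A :=
  iter n (fun y => psi (y, p)) x.

Definition pfix_fun (psi : A *p B -> A) (p : B) : A :=
  dsup (range (fun n => param_iter psi n \bot p)).

Variable psi : A *p B -> A.
Hypothesis psic : scott_continuous psi.

Let psi_homo (x x' : A) (p p' : B) :
  x <= x' -> p <= p' -> psi (x, p) <= psi (x', p').
Proof. by move=> xx' pp'; apply: (scott_continuous_homo psic); apply/andP. Qed.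

Lemma param_iter_homo n : {homo param_iter psi n \bot : p q / p <= q}.
Proof. by move=> p q pq; elim: n => [|n IHn] //=; apply: psi_homo. Qed.

Lemma param_iter_nondecreasing p :
  {homo (fun n => param_iter psi n \bot p) : m n / (m <= n)%N >-> m <= n}.
Proof.
apply: homo_leq => [x //|y x z xy yz|n]; first exact: le_trans xy yz.
by elim: n => [|n IHn]; [exact: le0x|apply: psi_homo].
Qed.

Lemma param_iter_directed p : directed (range (fun n => param_iter psi n \bot p)).
Proof.
split; first by exists (param_iter psi 0 \bot p), 0%N.
move=> _ _ [m _ <-] [n _ <-]; exists (param_iter psi (maxn m n) \bot p).
split; first by exists (maxn m n).
  by apply: (param_iter_nondecreasing p); rewrite leq_maxl.
by apply: (param_iter_nondecreasing p); rewrite leq_maxr.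
Qed.

Lemma pfix_funP p :
  isLub (range (fun n => param_iter psi n \bot p)) (pfix_fun psi p).
Proof. exact/dsupP/param_iter_directed. Qed.

Lemma param_iter_continuous n : scott_continuous (param_iter psi n \bot).
Proof.
elim: n => [|n IHn] D p dD pD.
  split=> [_ [q _ <-] //|b]; apply.
  by case: dD => -[q Dq] _; exists q.
pose g q : A *p B := (param_iter psi n \bot q, q).
have gh : {homo g : x y / x <= y}.
  by move=> x y xy; apply/andP; split=> //; apply: param_iter_homo.
have gl : isLub (g @` D) (g p).
  apply: isLub_pair.
    by rewrite image_comp; exact: IHn.
  by rewrite image_comp image_id.
by have := psic (directed_image gh dD) gl; rewrite image_comp.
Qed.

Lemma pfix_fun_continuous : scott_continuous (pfix_fun psi).
Proof.
move=> D p dD pD; split=> [_ [q Dq <-]|c uc].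
  have [_] := pfix_funP q; apply=> _ [n _ <-].
  have [+ _] := pfix_funP p => /(_ _ (imageP _ (I : setT n))); apply: le_trans.
  by apply: param_iter_homo; case: pD => + _; exact.
have [_] := pfix_funP p; apply=> _ [n _ <-].
have [_] := param_iter_continuous n dD pD; apply=> _ [q Dq <-].
apply: le_trans (uc _ (imageP _ Dq)).
by have [+ _] := pfix_funP q; apply; exists n.
Qed.

End Pfix.

Definition pfix {dA dB : Order.disp_t} {A : dcpoType dA} {B : dcpoType dB}
    (psi : cmap (A *p B) A) : cmap B A :=
  CMap (pfix_fun_continuous (cmap_continuous psi)).

(* The display [d] only selects notations; sharing it among all homsets imposes
   nothing on them. *)
Record dcpo_category (d : Order.disp_t) := DcpoCategory {
  obj :> Type;
  hom : obj -> obj -> dcpoType d;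
  idm : forall X, hom X X;
  comp : forall X Y Z, hom Y Z -> hom X Y -> hom X Z;
  comp_idl : forall X Y (f : hom X Y), comp (idm Y) f = f;
  comp_idr : forall X Y (f : hom X Y), comp f (idm X) = f;
  comp_assoc : forall X Y Z W (h : hom Z W) (g : hom Y Z) (f : hom X Y),
    comp h (comp g f) = comp (comp h g) f;
  comp_continuous : forall X Y Z,
    scott_continuous (fun gf : hom Y Z *p hom X Y => comp gf.1 gf.2);
  comp_botl : forall X Y Z (f : hom X Y), comp (\bot : hom Y Z) f = \bot;
  comp_botr : forall X Y Z (g : hom Y Z), comp g (\bot : hom X Y) = \bot
}.

Arguments hom {d C} X Y : rename.
Arguments idm {d C} X : rename.
Arguments comp {d C X Y Z} g f : rename.

Record dcpo_dagger_category (d : Order.disp_t) := DcpoDaggerCategory {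
  base_category :> dcpo_category d;
  dagger : forall X Y : base_category, hom X Y -> hom Y X;
  dagger_id : forall X : base_category, dagger (idm X) = idm X;
  dagger_comp : forall (X Y Z : base_category) (g : hom Y Z) (f : hom X Y),
    dagger (comp g f) = comp (dagger f) (dagger g);
  daggerK : forall (X Y : base_category) (f : hom X Y), dagger (dagger f) = f;
  dagger_homo : forall (X Y : base_category) (f g : hom X Y),
    f <= g -> dagger f <= dagger g
}.

Arguments dagger {d C X Y} f : rename.

Section Conjugate.
Context {d : Order.disp_t} {C : dcpo_dagger_category d}.

Definition functional (X Y P Q : C) := cmap (hom X Y *p hom P Q) (hom X Y).

Lemma dagger_isLub (X Y : C) (D : set (hom X Y)) (s : hom X Y) :
  isLub D s -> isLub (dagger @` D) (dagger s).
Proof.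
move=> [us ls]; split=> [_ [f Df <-]|c uc]; first exact/dagger_homo/us.
rewrite -[c]daggerK; apply/dagger_homo/ls => f Df.
by rewrite -[f]daggerK; apply/dagger_homo/uc; exists f.
Qed.

Context {X Y P Q : C}.

Definition conjugate_fun (psi : hom X Y *p hom P Q -> hom X Y)
    (gq : hom Y X *p hom Q P) : hom Y X :=
  dagger (psi (dagger gq.1, dagger gq.2)).

Lemma conjugate_fun_continuous (psi : hom X Y *p hom P Q -> hom X Y) :
  scott_continuous psi -> scott_continuous (conjugate_fun psi).
Proof.
move=> psic D s dD sD.
pose h (gq : hom Y X *p hom Q P) : hom X Y *p hom P Q :=
  (dagger gq.1, dagger gq.2).
have hh : {homo h : x y / x <= y}.
  by move=> x y /andP[xy1 xy2]; apply/andP; split; exact: dagger_homo.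
have hl : isLub (h @` D) (h s).
  case: sD => us ls; split=> [_ [x Dx <-]|[c1 c2] uc]; first exact/hh/us.
  have /andP[/= s1 s2] : s <= ((dagger c1, dagger c2) : hom Y X *p hom Q P).
    apply: ls => x Dx; have /andP[/= x1 x2] := uc _ (imageP h Dx).
    by apply/andP; split; rewrite -[X in X <= _]daggerK; exact: dagger_homo.
  by apply/andP; split=> /=; rewrite -[X in _ <= X]daggerK; exact: dagger_homo.
have := dagger_isLub (psic _ _ (directed_image hh dD) hl).
by rewrite !image_comp.
Qed.

Definition conjugate (psi : functional X Y P Q) : functional Y X Q P :=
  CMap (conjugate_fun_continuous (cmap_continuous psi)).

Definition pfix_adjoint (psi : functional X Y P Q)
    (psi' : functional Y X Q P) : Prop :=
  forall p : hom P Q, dagger (pfix psi p) = pfix psi' (dagger p).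

End Conjugate.

(* Main.v *)
Require Import Defs.
From mathcomp Require Import all_boot all_order.
From mathcomp Require Import boolp classical_sets.

(** A monotone involution between two posets is an order isomorphism, so the
    dagger preserves everything that is defined from the order alone: least
    elements and suprema.  The conjugate of [psi] is [psi] transported along
    this isomorphism, hence the dagger carries the Kleene chain of [psi] at [p],
    term by term, to the Kleene chain of the conjugate at [dagger p]
    ([dagger_param_iter]).  Both sides of the theorem are therefore suprema of
    the same chain. *)

Import Order.Theory.
Local Open Scope order_scope.

Section DaggerKleeneChain.
Context {d : Order.disp_t} {C : dcpo_dagger_category d}.

(** Transposing [\bot <= dagger \bot] along the involution shows that
    [dagger \bot] lies below [\bot]. *)
Lemma dagger_bot (X Y : C) : dagger (\bot : hom X Y) = \bot.
Proof.
apply/eqP; rewrite -lex0.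
by have := dagger_homo (le0x (dagger (\bot : hom Y X))); rewrite daggerK.
Qed.

(** The conjugate daggers its arguments before applying [psi], which cancels the
    outer dagger of the previous iterate: only the outermost one survives. *)
Lemma dagger_param_iter (X Y P Q : C) (psi : hom X Y *p hom P Q -> hom X Y)
    (n : nat) (f : hom X Y) (p : hom P Q) :
  dagger (param_iter psi n f p) =
  param_iter (conjugate_fun psi) n (dagger f) (dagger p).
Proof.
elim: n => [//|n IHn].
by rewrite [RHS]/= -IHn /conjugate_fun /= !daggerK.
Qed.

End DaggerKleeneChain.

Theorem theorem3 (d : Order.disp_t) (C : dcpo_dagger_category d)
  (X Y P Q : C) (psi : functional X Y P Q) :
  pfix_adjoint psi (conjugate psi).
Proof.
move=> p.
have := dagger_isLub (pfix_funP (cmap_continuous psi) p).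
have -> : (dagger @` range (fun n => param_iter psi n \bot p) =
           range (fun n => param_iter (conjugate psi) n \bot (dagger p)))%classic.
  rewrite image_comp; congr image; apply/funext => n /=.
  by rewrite dagger_param_iter dagger_bot.
move=> lub_dagger; apply: (isLub_uniq lub_dagger).
exact: pfix_funP (cmap_continuous (conjugate psi)) (dagger p).
Qed.
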